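(* Let $\mathbf n\ge 3$ and let $M^{red}_{\langle\mathbf n\rangle}=M_{\langle\mathbf n\rangle}-\sum_{j=1}^{\mathbf n}x^1_{\mathbf n}\otimes y^{\mathbf n}_j\otimes z^j_1$, where $M_{\langle\mathbf n\rangle}=\sum_{i,j,k=1}^{\mathbf n}x^i_j\otimes y^j_k\otimes z^k_i\in A\otimes B\otimes C$ with $\{x^i_j\},\{y^j_k\},\{z^k_i\}$ bases of $A,B,C\cong\mathbb C^{\mathbf n^2}$. Then $\underline{\mathbf R}(M^{red}_{\langle\mathbf n\rangle})\ge 2\mathbf n^2-\mathbf n$.
   Context: The border rank $\underline{\mathbf R}(T)$ of a tensor $T$ is the smallest $r$ such that $T$ is a limit of sums of $r$ rank one tensors $a\otimes b\otimes c$. *)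

(* Defs.v *)
From Stdlib Require Import Reals Arith.
Open Scope R_scope.

Definition C : Type := (R * R)%type.
Definition C0 : C := (0, 0).
Definition C1 : C := (1, 0).
Definition Cadd (x y : C) : C := (fst x + fst y, snd x + snd y).
Definition Cmul (x y : C) : C :=
  (fst x * fst y - snd x * snd y, fst x * snd y + snd x * fst y).
Definition Csub (x y : C) : C := (fst x - fst y, snd x - snd y).
Definition Cmod (x : C) : R := sqrt (fst x * fst x + snd x * snd x).

Fixpoint Csum (f : nat -> C) (r : nat) : C :=
  match r with O => C0 | S r' => Cadd (Csum f r') (f r') end.

(* A tensor in C^da (x) C^db (x) C^dc, given by its coordinates T p q s
   (only indices p < da, q < db, s < dc are meaningful). *)
Definition tensor := nat -> nat -> nat -> C.

Definition tensor_eq (da db dc : nat) (T U : tensor) : Prop :=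
  forall p q s, (p < da)%nat -> (q < db)%nat -> (s < dc)%nat -> T p q s = U p q s.

Definition sum_of_rank_one (da db dc r : nat) (T : tensor) : Prop :=
  exists (a b c : nat -> nat -> C),
    tensor_eq da db dc T
      (fun p q s => Csum (fun l => Cmul (Cmul (a l p) (b l q)) (c l s)) r).

Definition tensor_lim (da db dc : nat) (Tk : nat -> tensor) (T : tensor) : Prop :=
  forall eps, eps > 0 -> exists N, forall k, (N <= k)%nat ->
    forall p q s, (p < da)%nat -> (q < db)%nat -> (s < dc)%nat ->
      Cmod (Csub (Tk k p q s) (T p q s)) < eps.

Definition border_rank_le (da db dc : nat) (T : tensor) (r : nat) : Prop :=
  exists Tk : nat -> tensor,
    (forall k, sum_of_rank_one da db dc r (Tk k)) /\ tensor_lim da db dc Tk T.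

(* Bases: x^i_j of A is index i*n+j, y^j_k of B is j*n+k, z^k_i of C is k*n+i
   (0-based i,j,k < n). *)
Definition matmult_tensor (n : nat) : tensor := fun a b c =>
  if (Nat.eqb (a mod n) (b / n) && Nat.eqb (b mod n) (c / n)
      && Nat.eqb (c mod n) (a / n))%bool then C1 else C0.

(* M^red = M - sum_j x^1_n (x) y^n_j (x) z^j_1 : in 0-based indices, remove
   the terms with i = 0 and middle index j = n-1. *)
Definition matmult_red_tensor (n : nat) : tensor := fun a b c =>
  if (Nat.eqb (a mod n) (b / n) && Nat.eqb (b mod n) (c / n)
      && Nat.eqb (c mod n) (a / n)
      && negb (Nat.eqb (a / n) 0 && Nat.eqb (a mod n) (n - 1)))%bool
  then C1 else C0.

(* Main.v *)
Require Import Defs.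
From Stdlib Require Import Reals Arith.

(** Map the first factor onto C^(2n-1) by x^i_j |-> e_(i+j). A tensor then induces a
    Koszul flattening, from (n-1)-vectors of C^(2n-1) tensored with B* to n-vectors
    tensored with C. A rank one tensor gives a map of rank at most C(2n-2, n-1), and the
    source has dimension (2n^2 - n) C(2n-2, n-1). For the full matrix multiplication
    tensor the flattening is injective: it splits into n copies of the map sending
    e_S (x) v_j to the sum over i of (e_(i+j) /\ e_S) (x) u_i, which is triangular for
    the matching that pairs (T, i) with (T - t_i, t_i - i), t_i being the element of
    rank i in T. Removing x^1_n destroys only one diagonal entry in each copy, so the
    kernel for the reduced tensor has dimension at most n, and this loss is smaller
    than C(2n-2, n-1) as soon as n >= 3. *)

Module KoszulFlattening.

From mathcomp Require Import all_boot all_order all_algebra.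
From mathcomp Require Import zify ring.
From mathcomp Require Import Rstruct complex.
Set Implicit Arguments.
Unset Strict Implicit.
Unset Printing Implicit Defensive.
Import Order.TTheory GRing.Theory Num.Theory.
Local Open Scope ring_scope.

(** * Positions of elements within a finite set of ordinals *)

Section Below.

Variable m : nat.
Implicit Types (x y t : 'I_m) (T : {set 'I_m}).

(** Used twice: as the exponent of the sign in a wedge product, and as the rank of [x] in [T],
    counted from 0. *)
Definition below x T := #|[set t in T | (t < x)%N]|.

Lemma belowD1 x y T : y \in T -> below x T = ((y < x) + below x (T :\ y))%N.
Proof.
move=> yT; rewrite /below (cardsD1 y) inE yT /=; congr (_ + _)%N.
by apply: eq_card => t; rewrite !inE andbA.
Qed.

Lemma below_self x T : below x (x |: T) = below x T.
Proof.
rewrite /below; apply: eq_card => t; rewrite !inE.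
by case: eqP => //= ->; rewrite ltnn andbF.
Qed.

Lemma below_split x y T : (x <= y)%N ->
  below y T = (below x T + #|[set t in T | (x <= t < y)%N]|)%N.
Proof.
move=> xy; rewrite /below -(cardsID [set t : 'I_m | (t < x)%N]); congr (_ + _)%N.
  by apply: eq_card => t; rewrite !inE; case: (t \in T) => //=; lia.
by apply: eq_card => t; rewrite !inE; case: (t \in T) => //=; lia.
Qed.

(** Ranks increase strictly along [T] and stay under [#|T|], so they define an injective, hence
    bijective, self-map of ['I_#|T|]. *)
Lemma below_surj T j : (j < #|T|)%N -> exists2 x, x \in T & below x T = j.
Proof.
have inj : {in T &, injective (below^~ T)}.
  suff H x y : x \in T -> y \in T -> (x < y)%N -> (below x T < below y T)%N.
    move=> x y xT yT /= E; apply: val_inj.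
    case: (ltngtP x y) => // xy; [have := H _ _ xT yT xy | have := H _ _ yT xT xy].
      by rewrite E ltnn.
    by rewrite E ltnn.
  move=> xT yT xy; rewrite (below_split _ (ltnW xy)) -[X in (X < _)%N]addn0 ltn_add2l.
  by apply/card_gt0P; exists x; rewrite inE xT leqnn.
move=> jT; pose f (i : 'I_#|T|) := below (enum_val i) T.
have fT i : (f i < #|T|)%N.
  apply: (@leq_ltn_trans #|T :\ enum_val i|).
    apply: subset_leq_card; apply/subsetP => t; rewrite !inE => /andP[->].
    by rewrite andbT; apply: contraTneq => ->; rewrite ltnn.
  by rewrite [X in (_ < X)%N](cardsD1 (enum_val i)) enum_valP.
have gi : injective (fun i => Ordinal (fT i)).
  by move=> i1 i2 [] /inj E; apply: enum_val_inj; apply: E; apply: enum_valP.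
have [g _ gK] := injF_bij gi.
exists (enum_val (g (Ordinal jT))); first exact: enum_valP.
by have := congr1 val (gK (Ordinal jT)).
Qed.

End Below.

(** * Exterior multiplication by a fixed vector *)

Section Wedge.

Variables (F : fieldType) (m : nat).
Implicit Types (a : 'I_m -> F) (x y t : 'I_m) (S T : {set 'I_m}) (v : {set 'I_m} -> F).

Definition ksign x T : F := (-1) ^+ below x T.

(* [v S] is the coordinate on the basis vector e_S of an element of the exterior
   algebra of F^m, and [wedge a v] is a /\ v. *)
Definition wedge a v T := \sum_(x in T) a x * ksign x T * v (T :\ x).

Lemma ksign_sqr x T : ksign x T * ksign x T = 1.
Proof. by rewrite /ksign -expr2 sqrr_sign. Qed.

Lemma ksignD1 x y T : y \in T -> ksign x T = (-1) ^+ (y < x)%N * ksign x (T :\ y).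
Proof. by move=> yT; rewrite /ksign (belowD1 x yT) exprD. Qed.

Lemma ksign_swap x y T : x \in T -> y \in T -> x != y ->
  ksign x T * ksign y (T :\ x) = - (ksign y T * ksign x (T :\ y)).
Proof.
move=> xT yT xy; rewrite (ksignD1 x yT) (ksignD1 y xT).
have -> : (x < y)%N = ~~ (y < x)%N.
  by rewrite -leqNgt ltn_neqAle (xy : x != y :> nat).
by case: (y < x)%N; rewrite /= ?expr1 ?expr0; ring.
Qed.

(* The terms are antisymmetric in the two removed elements; splitting the double
   sum at y < x avoids dividing by 2. *)
Lemma wedge_wedge a v T : wedge a (wedge a v) T = 0.
Proof.
pose G x y := a x * ksign x T * (a y * ksign y (T :\ x) * v (T :\ x :\ y)).
have -> : wedge a (wedge a v) T = \sum_(x in T) \sum_(y in T | y != x) G x y.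
  apply: eq_bigr => x xT; rewrite /wedge big_distrr /=.
  by apply: eq_bigl => y; rewrite !inE andbC.
have GN x y : x \in T -> y \in T -> x != y -> G x y = - G y x.
  move=> xT yT xy; rewrite /G setDDl setUC -setDDl.
  rewrite [LHS](_ : _ = a x * a y * v (T :\ y :\ x) * (ksign x T * ksign y (T :\ x))).
    by rewrite ksign_swap //; ring.
  by ring.
rewrite (eq_bigr (fun x => \sum_(y in T | (y < x)%N) G x y
    + \sum_(y in T | (x < y)%N) G x y)).
  rewrite big_split /= [X in _ + X](exchange_big_dep (mem T)) /=; last first.
    by move=> x y _ /andP[].
  rewrite -big_split big1 //= => x xT.
  rewrite [X in _ + X](_ : _ = - \sum_(y in T | (y < x)%N) G x y) ?subrr //.
  rewrite -sumrN; apply: eq_big => [y|y /andP[yT]]; first by rewrite xT.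
  by move=> /andP[_ yx]; apply: GN => //; rewrite neq_ltn yx.
move=> x xT; rewrite (bigID (fun y : 'I_m => (y < x)%N)) /=; congr (_ + _).
  apply: eq_bigl => y; case: (y \in T) => //=; rewrite -val_eqE /=; lia.
apply: eq_bigl => y; case: (y \in T) => //=; rewrite -val_eqE /=; lia.
Qed.

(* The contraction of (a /\ v) / a_x0 by the coordinate x0. It has no component on
   the S containing x0, and a /\ - does not distinguish it from v: this is how
   a /\ - on the k-vectors is seen to have rank at most 'C(m - 1, k). *)
Definition normalize_at x0 a v S :=
  if x0 \in S then 0 else ksign x0 S / a x0 * wedge a v (x0 |: S).

(** If [x0] is in [T], only the term removing [x0] survives. Otherwise a /\ (a /\ v) = 0, read at
    [x0 |: T], expresses the coordinate at [T] through those at sets containing [x0]. *)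
Lemma wedge_normalize_at x0 a v T : a x0 != 0 ->
  wedge a (normalize_at x0 a v) T = wedge a v T.
Proof.
move=> a0; case: (boolP (x0 \in T)) => x0T.
  rewrite {1}/wedge (big_setD1 x0) //= big1 ?addr0.
    rewrite /normalize_at !inE eqxx /= setD1K //.
    rewrite (ksignD1 x0 x0T) ltnn expr0 mul1r.
    rewrite [LHS](_ : _ = (a x0 / a x0) * (ksign x0 (T :\ x0) * ksign x0 (T :\ x0))
      * wedge a v T).
      by rewrite divff // ksign_sqr !mul1r.
    by field.
  move=> x; rewrite !inE => /andP[xx0 xT].
  by rewrite /normalize_at !inE eq_sym xx0 x0T mulr0.
have := wedge_wedge a v (x0 |: T).
rewrite {1}/wedge big_setU1 //= setU1K // => /eqP; rewrite addrC addr_eq0 => /eqP E.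
have Es : ksign x0 (x0 |: T) = ksign x0 T by rewrite /ksign below_self.
transitivity (- (ksign x0 T / a x0) *
  \sum_(i in T) a i * ksign i (x0 |: T) * wedge a v ((x0 |: T) :\ i)).
  rewrite {1}/wedge big_distrr; apply: eq_bigr => x xT /=.
  have xx0 : x != x0 by apply: contraNneq x0T => <-.
  have E1 : x0 |: (T :\ x) = (x0 |: T) :\ x.
    by apply/setP => y; rewrite !inE; case: (eqVneq y x0) => // ->; rewrite eq_sym xx0.
  rewrite /normalize_at !inE (negPf x0T) andbF E1.
  have := ksign_swap (setU1r x0 xT) (setU11 x0 T) xx0.
  rewrite setU1K // Es.
  have -> : ksign x0 ((x0 |: T) :\ x) = ksign x0 (T :\ x) by rewrite -E1 /ksign below_self.
  move=> H.
  have H2 : ksign x T * ksign x0 (T :\ x) = - (ksign x (x0 |: T) * ksign x0 T).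
    transitivity (ksign x0 T * ksign x0 T * (ksign x T * ksign x0 (T :\ x))).
      by rewrite ksign_sqr mul1r.
    transitivity (- (ksign x (x0 |: T) * ksign x0 T)
                  * (ksign x0 (T :\ x) * ksign x0 (T :\ x))).
      rewrite [LHS](_ : _ = - - (ksign x0 T * ksign x T)
                            * (ksign x0 T * ksign x0 (T :\ x))); last by ring.
      by rewrite -H; ring.
    by rewrite ksign_sqr mulr1.
  rewrite [LHS](_ : _ = a x / a x0 * wedge a v ((x0 |: T) :\ x)
                        * (ksign x T * ksign x0 (T :\ x))); last by ring.
  by rewrite H2; ring.
rewrite E Es [LHS](_ : _ = (a x0 / a x0) * (ksign x0 T * ksign x0 T) * wedge a v T);
  last by ring.
by rewrite divff // ksign_sqr !mul1r.
Qed.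

End Wedge.

(** * A potential that orders the matching *)

Section Potential.

Variable m : nat.
Implicit Types (x y t : 'I_m) (S T : {set 'I_m}).

(* By [pot_setD1], pot (T :\ y) (y - i) = c - 2 g(y), where c depends on T and i only
   and g(y) = \sum_(t in T) `|t - y| + (#|T| - 1 - 2 i) y. On T the convex function g
   has a strict minimum at the element of rank i. *)
Definition pot S (j : nat) : int :=
  \sum_(t in S) \sum_(u in S) `|t%:Z - u%:Z|
  + 2 * \sum_(t in S) (#|S|%:Z * t%:Z - t%:Z ^+ 2) - 2 * j%:Z ^+ 2.

Lemma sum_below x T : \sum_(t in T) ((t < x)%N : nat)%:Z = (below x T)%:Z.
Proof.
rewrite /below -sum1_card (big_morph _ PoszD (erefl : 0%:Z = 0)).
rewrite [LHS]big_mkcond [RHS]big_mkcond; apply: eq_bigr => t _.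
by rewrite inE; case: (t \in T); case: (t < x)%N.
Qed.

Lemma pot_setD1 y T i j : y \in T -> y = (i + j)%N :> nat ->
  pot (T :\ y) j =
  \sum_(t in T) \sum_(u in T) `|t%:Z - u%:Z|
  + 2 * \sum_(t in T) ((#|T|%:Z - 1) * t%:Z - t%:Z ^+ 2) - 2 * i%:Z ^+ 2
  - 2 * (\sum_(t in T) `|t%:Z - y%:Z| + (#|T|%:Z - 1 - 2 * i%:Z) * y%:Z).
Proof.
move=> yT yij; rewrite /pot.
have -> : #|T :\ y|%:Z = #|T|%:Z - 1.
  by rewrite (cardsD1 y T) yT PoszD addrC addKr.
have H (f : 'I_m -> int) : \sum_(t in T) f t = f y + \sum_(t in T :\ y) f t.
  exact: big_setD1.
have -> : \sum_(t in T) \sum_(u in T) `|t%:Z - u%:Z|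
    = 2 * \sum_(t in T :\ y) `|t%:Z - y%:Z|
      + \sum_(t in T :\ y) \sum_(u in T :\ y) `|t%:Z - u%:Z|.
  rewrite H H subrr normr0 add0r (eq_bigr (fun t => `|t%:Z - y%:Z|)); last first.
    by move=> t _; rewrite distrC.
  rewrite [X in _ + X](eq_bigr (fun t : 'I_m =>
    `|t%:Z - y%:Z| + \sum_(u in T :\ y) `|t%:Z - u%:Z|)).
    by rewrite big_split /= addrA mulr2n mulrDl !mul1r.
  by move=> t _; rewrite H.
rewrite (H (fun t => _ * _ - _)) (H (fun t => `|t%:Z - y%:Z|)) subrr normr0.
have -> : j%:Z = y%:Z - i%:Z by rewrite yij PoszD addrC addKr.
by ring.
Qed.

Lemma pot_lt x y T i j j' : x \in T -> y \in T -> x != y -> below x T = i ->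
  x = (i + j)%N :> nat -> y = (i + j')%N :> nat -> pot (T :\ y) j' < pot (T :\ x) j.
Proof.
move=> xT yT xy bi xij yij; rewrite (pot_setD1 xT xij) (pot_setD1 yT yij).
rewrite ltrD2l ltrN2 ltr_pM2l // -subr_gt0.
set p := #|T|%:Z - 1.
have pE : p = #|T :\ x|%:Z by rewrite /p (cardsD1 x T) xT PoszD addrC addKr.
have bE : below x (T :\ x) = i by rewrite -bi (belowD1 x xT) ltnn.
rewrite (big_setD1 x) //= [X in _ < _ - (X + _)](big_setD1 x) //= subrr normr0 add0r.
(* Subgradient inequality for each [|t - y|] at [x]. Exactly [i] elements of [T :\ x] lie below [x],
   so the slopes add up to [2 i - p], which cancels the linear term of g. The term t = x is kept
   apart: its [|x - y|] makes the inequality strict. *)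
have H : (y%:Z - x%:Z) * (2 * i%:Z - p)
    <= \sum_(t in T :\ x) `|t%:Z - y%:Z| - \sum_(t in T :\ x) `|t%:Z - x%:Z|.
  rewrite -sumrB [X in X <= _](_ : _ =
    \sum_(t in T :\ x) (y%:Z - x%:Z) * (2 * ((t < x)%N : nat)%:Z - 1)).
    apply: ler_sum => t; rewrite !inE -val_eqE /= => /andP[tx _].
    by case: (ltnP t x) => /= ?; lia.
  rewrite -big_distrr /= big_split /= -big_distrr /= sum_below bE; congr (_ * (_ + _)).
  by rewrite sumr_const mulNrn pE natz.
have D : 0 < `|x%:Z - y%:Z| by rewrite normr_gt0 subr_eq0.
apply: lt_le_trans D _; move: H; rewrite -subr_ge0 => H; rewrite -subr_ge0.
by congr (0 <= _): H; ring.
Qed.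

End Potential.

(** * Cardinalities of sets of ordinals *)

Section OrdinalSets.

Variable m : nat.
Implicit Types (x y t : 'I_m) (S T : {set 'I_m}).

Lemma card_ltn_ord k : (k <= m)%N -> #|[set t : 'I_m | (t < k)%N]| = k.
Proof.
move=> km; have inj : injective (widen_ord km) by move=> i j /(congr1 val) /= /val_inj.
rewrite -[RHS]card_ord -cardsT -(card_imset _ inj); apply: eq_card => t.
rewrite inE; apply/idP/imsetP => [tk | [i _ ->]]; last exact: (ltn_ord i).
by exists (Ordinal tk) => //; apply: val_inj.
Qed.

Lemma below_setC x S : (below x S + below x (~: S))%N = x.
Proof.
rewrite -[RHS](card_ltn_ord (ltnW (ltn_ord x))) -(cardsID S) /below.
by congr (_ + _)%N; apply: eq_card => t; rewrite !inE andbC.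
Qed.

Lemma card_draws_notin x k :
  #|[set S : {set 'I_m} | (x \notin S) && (#|S| == k)]| = 'C(m.-1, k).
Proof.
have <- : #|[set~ x]| = m.-1 by rewrite cardsC1 card_ord.
rewrite -cards_draws; apply: eq_card => S; rewrite !inE; congr (_ && _).
by rewrite subsetC sub1set inE.
Qed.

End OrdinalSets.

(** * The Koszul flattening and its rank on sums of rank one tensors *)

Section Flattening.

Variables (F : fieldType) (n : nat).
Let m := (n + n).-1.
Let cell := ('I_n * 'I_n)%type.
Let index := ({set 'I_m} * cell)%type.
Implicit Types (p q : index) (P : {set index}).

(* The linear map x^i_j |-> e_(i + j) carries the first factor onto F^m. *)
Definition koszul (t : cell -> cell -> cell -> F) p q : F :=
  wedge (fun x : 'I_m => \sum_(al : cell | (al.1 + al.2)%N == x) t al p.2 q.2)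
        (fun S => (S == p.1)%:R) q.1.

(** The source indexes the rows, so injectivity is [row_free]. The target keeps subsets of every
    size; those of the wrong size only contribute zero columns. *)
Definition flattening t P : 'M[F]_(#|P|, #|{: index}|) :=
  \matrix_(i, j) koszul t (enum_val i) (enum_val j).

Lemma wedge_sum_l (r : nat) (a : 'I_r -> 'I_m -> F) v (T : {set 'I_m}) :
  wedge (fun x => \sum_(l < r) a l x) v T = \sum_(l < r) wedge (a l) v T.
Proof.
rewrite /wedge exchange_big /=; apply: eq_bigr => x _.
by rewrite !big_distrl.
Qed.

Lemma koszul_sum (r : nat) (t : 'I_r -> cell -> cell -> cell -> F) p q :
  koszul (fun al be ga => \sum_(l < r) t l al be ga) p q = \sum_(l < r) koszul (t l) p q.
Proof.
rewrite /koszul -wedge_sum_l; apply: eq_bigr => x _.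
by rewrite exchange_big.
Qed.

Lemma wedge_delta a (v : {set 'I_m} -> F) T :
  wedge a v T = \sum_S v S * wedge a (fun S' => (S' == S)%:R) T.
Proof.
rewrite /wedge; under [RHS]eq_bigr do rewrite big_distrr.
rewrite exchange_big /=; apply: eq_bigr => x _.
rewrite (bigD1 (T :\ x)) //= eqxx mulr1 big1 ?addr0 1?mulrC // => S ST.
by rewrite eq_sym (negPf ST) !mulr0.
Qed.

Lemma wedge_delta_card (a : 'I_m -> F) (S T : {set 'I_m}) : #|T| != #|S|.+1 ->
  wedge a (fun S' => (S' == S)%:R) T = 0.
Proof.
move=> c; apply: big1 => x xT; case: eqP => [E|]; last by rewrite mulr0.
by move: c; rewrite (cardsD1 x T) xT E eqxx.
Qed.

(** The map is a scalar multiple, entry by entry, of a' /\ -, where a' is the image of [a].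
    Normalizing at a nonzero coordinate [x0] of a' factors it through the e_S with [#|S| = k] and
    [x0] outside S. *)
Lemma rank_flattening_rank_one (a b c : cell -> F) P k :
  (forall p, p \in P -> #|p.1| = k) ->
  (\rank (flattening (fun al be ga => (a al * b be * c ga)%R) P) <= 'C(m.-1, k))%N.
Proof.
move=> Pk; pose a' (x : 'I_m) := \sum_(al : cell | (al.1 + al.2)%N == x) a al.
pose del (S : {set 'I_m}) S' : F := (S' == S)%:R.
have kosz p q : koszul (fun al be ga => a al * b be * c ga) p q
    = b p.2 * c q.2 * wedge a' (del p.1) q.1.
  rewrite /koszul /wedge big_distrr /=; apply: eq_bigr => x _.
  rewrite (_ : \sum_(al : cell | _) _ = a' x * (b p.2 * c q.2)).
    by rewrite /del; ring.
  by rewrite /a' big_distrl; apply: eq_bigr => al _; rewrite -mulrA.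
have [/forallP a0 | /forallPn[x0 a0]] := boolP [forall x, a' x == 0].
  rewrite (_ : flattening _ _ = 0) ?mxrank0 //; apply/matrixP => i j; rewrite !mxE kosz.
  by rewrite /wedge big1 ?mulr0 // => x _; rewrite (eqP (a0 x)) !mul0r.
pose D := [set S : {set 'I_m} | (x0 \notin S) && (#|S| == k)].
pose U := \matrix_(i < #|P|, s < #|D|)
  (b (enum_val i).2 * normalize_at x0 a' (del (enum_val i).1) (enum_val s)).
pose V := \matrix_(s < #|D|, j < #|{: index}|)
  (wedge a' (del (enum_val s)) (enum_val j).1 * c (enum_val j).2).
have -> : flattening (fun al be ga => a al * b be * c ga) P = U *m V.
  apply/matrixP => i j; rewrite !mxE kosz -(wedge_normalize_at _ _ a0) wedge_delta.
  under [RHS]eq_bigr do rewrite !mxE.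
  rewrite -(big_enum_val (fun S =>
    b (enum_val i).2 * normalize_at x0 a' (del (enum_val i).1) S
    * (wedge a' (del S) (enum_val j).1 * c (enum_val j).2))) /=.
  rewrite big_distrr [LHS](bigID (mem D)) /= [X in _ + X]big1 ?addr0.
    by apply: eq_bigr => S _; ring.
  move=> S; rewrite inE negb_and negbK => SD.
  suff -> : normalize_at x0 a' (del (enum_val i).1) S = 0 by rewrite mul0r mulr0.
  rewrite /normalize_at; case: ifP SD => //= x0S Sk.
  rewrite /del wedge_delta_card ?mulr0 // cardsU1 x0S (Pk _ (enum_valP i)).
  by rewrite add1n eqSS.
apply: leq_trans (mxrankM_maxl _ _) _; apply: leq_trans (rank_leq_col _) _.
by rewrite card_draws_notin.
Qed.

Lemma rank_flattening (r : nat) (a b c : 'I_r -> cell -> F) P k :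
  (forall p, p \in P -> #|p.1| = k) ->
  (\rank (flattening (fun al be ga => \sum_(l < r) a l al * b l be * c l ga)%R P)
     <= r * 'C(m.-1, k))%N.
Proof.
move=> Pk.
have -> : flattening (fun al be ga => \sum_(l < r) a l al * b l be * c l ga) P
   = \sum_(l < r) flattening (fun al be ga => a l al * b l be * c l ga) P.
  apply/matrixP => i j; rewrite !mxE koszul_sum summxE.
  by apply: eq_bigr => l _; rewrite mxE.
rewrite -[X in (_ <= X * _)%N]card_ord -sum_nat_const.
elim/big_ind2: _ => [|x1 x2 y1 y2 H1 H2|l _]; first by rewrite mxrank0.
  exact: leq_trans (mxrank_add _ _) (leq_add H1 H2).
exact: rank_flattening_rank_one.
Qed.

(** * Injectivity of the flattening of the reduced tensor *)

Definition red (al be ga : cell) : F :=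
  [&& al.2 == be.1, be.2 == ga.1, ga.2 == al.1 &
      ~~ ((al.1 == 0%N :> nat) && (al.2 == n.-1 :> nat))]%:R.

Lemma koszul_red p q : koszul red p q =
  \sum_(x in q.1) [&& (q.2.2 + p.2.1 == x)%N, p.2.2 == q.2.1,
    ~~ ((q.2.2 == 0%N :> nat) && (p.2.1 == n.-1 :> nat)) & q.1 :\ x == p.1]%:R
  * ksign F x q.1.
Proof.
rewrite /koszul /wedge; apply: eq_bigr => x _.
(* The indices of the other two factors determine the only variable of the first factor that can
   contribute. *)
rewrite big_mkcond (bigD1 (q.2.2, p.2.1)) //= big1 ?addr0.
  rewrite /red /= !eqxx /=.
  case: ((q.2.2 + p.2.1)%N == x) => /=; last by rewrite ?mulr0n !mul0r.
  case: (p.2.2 == q.2.1) => /=; last by rewrite ?mulr0n !mul0r.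
  case: (~~ _) => /=; last by rewrite ?mulr0n !mul0r.
  by rewrite mul1r mulrC.
move=> [i j] ne; case: ifP => // _.
rewrite /red /= [X in nat_of_bool X](_ : _ = false) //; apply/negbTE.
by apply: contra ne => /and4P[/eqP -> _ /eqP -> _].
Qed.

Lemma koszul_red_neq0 p q : koszul red p q != 0 ->
  exists x : 'I_m,
    [/\ x \in q.1, x = (q.2.2 + p.2.1)%N :> nat, p.2.2 = q.2.1 & p.1 = q.1 :\ x].
Proof.
move=> nz.
pose edge (x : 'I_m) := [&& x \in q.1, (q.2.2 + p.2.1 == x)%N, p.2.2 == q.2.1,
  ~~ ((q.2.2 == 0%N :> nat) && (p.2.1 == n.-1 :> nat)) & q.1 :\ x == p.1].
have [/existsP[x /and5P[xT /eqP xE /eqP kk _ /eqP E]] | /existsPn H] :=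
    boolP [exists x, edge x].
  by exists x; split.
case/eqP: nz; rewrite koszul_red big1 // => x xT.
by have := H x; rewrite /edge xT /= => /negPf ->; rewrite mul0r.
Qed.

Lemma koszul_red_match (x : 'I_m) (T : {set 'I_m}) (i j k : 'I_n) :
  x \in T -> x = (i + j)%N :> nat -> ~~ ((i == 0%N :> nat) && (j == n.-1 :> nat)) ->
  koszul red (T :\ x, (j, k)) (T, (k, i)) != 0.
Proof.
move=> xT xij ok; rewrite koszul_red (bigD1 x) //= big1 ?addr0.
  by rewrite -xij !eqxx ok mul1r /ksign signr_eq0.
by move=> y /andP[_ yx]; rewrite -xij -[_ == _ :> nat]/(x == y) eq_sym (negPf yx) mul0r.
Qed.

(* (S, j) is matched with (x |: S, x - j), where x is the element of rank j in the
   complement of S; the excluded (S, j) is the one for which x - j = 0 and j = n - 1,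
   where the entry of the flattening vanishes because that variable was removed. *)
Definition columns : {set index} :=
  [set p : index | (#|p.1| == n.-1) &&
    ~~ ((p.2.1 == n.-1 :> nat) && (p.1 == [set x : 'I_m | (n <= x)%N]))].

Lemma koszul_red_pivot p : p \in columns -> exists q : index,
  koszul red p q != 0 /\
  forall p', koszul red p' q != 0 -> p' != p -> pot p'.1 p'.2.1 < pot p.1 p.2.1.
Proof.
case: p => [S [j k]]; rewrite inE /= => /andP[/eqP Sn bad].
have n0 : (0 < n)%N by apply: leq_ltn_trans (ltn_ord j).
(* The complement of [S] has (2n - 1) - (n - 1) = n elements, so every [j] is a rank in it. *)
have jC : (j < #|~: S|)%N.
  rewrite cardsCs setCK card_ord Sn; apply: leq_trans (ltn_ord j) _; rewrite /m; lia.
have [x xS bx] := below_surj jC; rewrite inE in xS.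
(* Hence x - j is the rank of [x] in [x |: S], the condition under which [pot_lt] applies. *)
have xE := below_setC x S; rewrite bx in xE.
have bn : (below x S < n)%N.
  rewrite -(prednK n0) ltnS -Sn subset_leq_card //.
  by apply/subsetP => t; rewrite inE => /andP[].
pose i := Ordinal bn; pose T := x |: S.
have ST : S = T :\ x by rewrite setU1K.
have xT : x \in T by rewrite setU11.
(* Otherwise x = n - 1 and no element of [S] is below it, so the n - 1 elements of [S] fill {n, ...,
   2n - 2}: the pair excluded from [columns]. *)
have ok : ~~ ((i == 0%N :> nat) && (j == n.-1 :> nat)).
  apply: contra bad => /andP[/eqP i0 /eqP jn]; rewrite jn eqxx /=.
  have xn : x = n.-1 :> nat by rewrite -xE -jn [below x S]i0.
  rewrite eqEcard; apply/andP; split.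
    apply/subsetP => t tS; rewrite inE leqNgt; apply/negP => tn.
    move/eqP: i0; rewrite /= cards_eq0 => /eqP/setP/(_ t); rewrite !inE tS /=.
    have : t != x by apply: contraNneq xS => <-.
    by rewrite -val_eqE /= xn; lia.
  have -> : [set y : 'I_m | (n <= y)%N] = ~: [set y : 'I_m | (y < n)%N].
    by apply/setP => y; rewrite !inE -leqNgt.
  by rewrite cardsCs setCK card_ltn_ord ?card_ord ?Sn /m; lia.
exists (T, (k, i)); split; first by rewrite {1}ST; apply: koszul_red_match.
move=> [S' [j' k']] /koszul_red_neq0 /= [y [yT yE -> S'E]] ne.
rewrite S'E ST; apply: (@pot_lt _ x y T i j j') => //.
  apply: contra ne => /eqP xy; apply/eqP; rewrite S'E -xy -ST; congr (_, (_, _)).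
  by apply/val_inj/(@addnI i) => /=; rewrite -yE -xy xE.
by rewrite /T below_self.
Qed.

(** In a nontrivial relation, take a row of least potential with nonzero coefficient. Any other row
    meeting its pivot column has smaller potential, hence coefficient zero, so the pivot entry
    cannot be cancelled. *)
Lemma row_free_flattening_red : row_free (flattening red columns).
Proof.
apply: inj_row_free => v vM; apply/rowP => i0; rewrite [RHS]mxE.
apply/eqP/negPn/negP => vi0.
pose po (i : 'I_#|columns|) := pot (enum_val i).1 (enum_val i).2.1.
have [i vi min_i] := @arg_minP _ _ _ i0 (fun i => v 0 i != 0) po vi0.
have [q [nz piv]] := koszul_red_pivot (enum_valP i).
have := congr1 (fun w : 'rV_#|{: index}| => w 0 (enum_rank q)) vM; rewrite !mxE.
rewrite (bigD1 i) //= big1 ?addr0.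
  by rewrite mxE enum_rankK => /eqP; rewrite mulf_eq0 (negPf vi) (negPf nz).
move=> i' ii'; rewrite mxE enum_rankK; apply/eqP; rewrite mulf_eq0 -implyNb.
apply/implyP => vi'.
apply: contraTT (min_i i' vi') => nz'; rewrite -ltNge; apply: piv => //.
by apply: contra ii' => /eqP/enum_val_inj ->.
Qed.

Lemma card_columns : (0 < n)%N -> (n * n * 'C(m, n.-1) <= #|columns| + n)%N.
Proof.
move=> n0; have nn : (n.-1 < n)%N by rewrite prednK.
pose A := setX [set S : {set 'I_m} | #|S| == n.-1] [set: cell].
pose E := setX [set [set x : 'I_m | (n <= x)%N]] (setX [set Ordinal nn] [set: 'I_n]).
have cA : #|A| = (n * n * 'C(m, n.-1))%N.
  by rewrite cardsX card_draws cardsT card_prod !card_ord mulnC.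
have cE : #|E| = n by rewrite !cardsX !cards1 cardsT card_ord !mul1n.
rewrite -cA -[X in (_ <= _ + X)%N]cE.
apply: leq_trans (leq_card_setU columns E).1; apply: subset_leq_card.
apply/subsetP => -[S [j k]]; rewrite !inE /= !andbT -val_eqE /= => ->.
by rewrite [X in _ || X]andbC orNb.
Qed.

End Flattening.

(** * Complex limits and semicontinuity of rank *)

Section Limits.

Definition cvgC (u : nat -> R[i]) (l : R[i]) :=
  Un_cv (fun k => complex.Re (u k)) (complex.Re l) /\
  Un_cv (fun k => complex.Im (u k)) (complex.Im l).

Lemma cvgC_ext u v l : u =1 v -> cvgC u l -> cvgC v l.
Proof.
by move=> uv [u1 u2]; split; [apply: Un_cv_ext u1 | apply: Un_cv_ext u2] => k; rewrite uv.
Qed.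

Lemma cvgC_cst c : cvgC (fun=> c) c.
Proof.
by split=> eps eps0; exists 0%N => k _; rewrite /Rdist Rminus_diag Rabs_R0.
Qed.

Lemma cvgCD u v a b : cvgC u a -> cvgC v b -> cvgC (fun k => u k + v k) (a + b).
Proof.
move=> [u1 u2] [v1 v2]; case: a b u1 u2 v1 v2 => [a1 a2] [b1 b2] /= u1 u2 v1 v2.
split=> /=.
  have := CV_plus _ _ _ _ u1 v1; apply: Un_cv_ext => k.
  by case: (u k) (v k) => [? ?] [].
have := CV_plus _ _ _ _ u2 v2; apply: Un_cv_ext => k.
by case: (u k) (v k) => [? ?] [].
Qed.

Lemma cvgCM u v a b : cvgC u a -> cvgC v b -> cvgC (fun k => u k * v k) (a * b).
Proof.
move=> [u1 u2] [v1 v2]; case: a b u1 u2 v1 v2 => [a1 a2] [b1 b2] /= u1 u2 v1 v2.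
split=> /=.
  have := CV_minus _ _ _ _ (CV_mult _ _ _ _ u1 v1) (CV_mult _ _ _ _ u2 v2).
  by apply: Un_cv_ext => k; case: (u k) (v k) => [? ?] [].
have := CV_plus _ _ _ _ (CV_mult _ _ _ _ u1 v2) (CV_mult _ _ _ _ u2 v1).
by apply: Un_cv_ext => k; case: (u k) (v k) => [? ?] [].
Qed.

Lemma cvgC_sum (I : Type) (s : seq I) (P : pred I) (u : I -> nat -> R[i]) a :
  (forall i, P i -> cvgC (u i) (a i)) ->
  cvgC (fun k => \sum_(i <- s | P i) u i k) (\sum_(i <- s | P i) a i).
Proof.
move=> ua; elim: s => [|i s IH].
  by rewrite big_nil; apply: cvgC_ext (cvgC_cst 0) => k; rewrite big_nil.
rewrite big_cons; case: ifP => Pi.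
  by apply: cvgC_ext (cvgCD (ua i Pi) IH) => k; rewrite big_cons Pi.
by apply: cvgC_ext IH => k; rewrite big_cons Pi.
Qed.

Lemma cvgC_prod (I : Type) (s : seq I) (u : I -> nat -> R[i]) a :
  (forall i, cvgC (u i) (a i)) ->
  cvgC (fun k => \prod_(i <- s) u i k) (\prod_(i <- s) a i).
Proof.
move=> ua; elim: s => [|i s IH].
  by rewrite big_nil; apply: cvgC_ext (cvgC_cst 1) => k; rewrite big_nil.
by rewrite big_cons; apply: cvgC_ext (cvgCM (ua i) IH) => k; rewrite big_cons.
Qed.

Lemma cvgC_unique u a b : cvgC u a -> cvgC u b -> a = b.
Proof.
move=> [u1 u2] [v1 v2]; case: a b u1 u2 v1 v2 => [a1 a2] [b1 b2] /= u1 u2 v1 v2.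
by rewrite (UL_sequence _ _ _ u1 v1) (UL_sequence _ _ _ u2 v2).
Qed.

Lemma cvgC_det N (A : nat -> 'M[R[i]]_N) (L : 'M_N) :
  (forall i j, cvgC (fun k => A k i j) (L i j)) -> cvgC (fun k => \det (A k)) (\det L).
Proof.
move=> AL; apply: cvgC_sum => s _; apply: cvgCM; first exact: cvgC_cst.
by apply: cvgC_prod.
Qed.

(** With [B] a right inverse of [L], det(A_k B) tends to 1; were d < N, all these determinants would
    vanish. *)
Lemma mxrank_limit_free N M (A : nat -> 'M[R[i]]_(N, M)) (L : 'M_(N, M)) d :
  (forall i j, cvgC (fun k => A k i j) (L i j)) -> row_free L ->
  (forall k, (\rank (A k) <= d)%N) -> (N <= d)%N.
Proof.
move=> AL /row_freeP[B LB] Ad; rewrite leqNgt; apply/negP => dN.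
have := cvgC_det (A := fun k => A k *m B) (L := L *m B).
have AB i j : cvgC (fun k => (A k *m B) i j) ((L *m B) i j).
  rewrite mxE; apply: (@cvgC_ext (fun k => \sum_l A k i l * B l j)) => [k|].
    by rewrite mxE.
  by apply: cvgC_sum => l _; apply: cvgCM => //; apply: cvgC_cst.
move=> /(_ AB) D.
suff D0 : cvgC (fun k => \det (A k *m B)) 0.
  by have /eqP := cvgC_unique D D0; rewrite LB det1 oner_eq0.
apply: cvgC_ext (cvgC_cst 0) => k; apply/esym/eqP; apply: contraTT dN => dk.
rewrite -leqNgt; apply: leq_trans (Ad k); apply: leq_trans (mxrankM_maxl _ B).
by rewrite mxrank_unit // unitmxE unitfE.
Qed.

End Limits.

(** * Transfer from coordinate tensors to tensors on pairs of indices over [R[i]] *)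

Section BorderRank.

Definition toC (z : Defs.C) : R[i] := Complex z.1 z.2.

Lemma toC_sum (f : nat -> Defs.C) r : toC (Csum f r) = \sum_(l < r) toC (f l).
Proof.
elim: r => [|r IH] /=; first by rewrite big_ord0.
by rewrite big_ord_recr /= -IH.
Qed.

Lemma Rabs_Cmod (z : Defs.C) : Rle (Rabs z.1) (Cmod z) /\ Rle (Rabs z.2) (Cmod z).
Proof.
case: z => a b; rewrite /Cmod /= -!sqrt_Rsqr_abs /Rsqr.
have a2 := Rle_0_sqr a; have b2 := Rle_0_sqr b; rewrite /Rsqr in a2 b2.
by split; apply: sqrt_le_1_alt; Lra.lra.
Qed.

Variable n : nat.
Let cell := ('I_n * 'I_n)%type.

Definition cells (T : tensor) (al be ga : cell) : R[i] :=
  toC (T (al.1 * n + al.2)%N (be.1 * n + be.2)%N (ga.1 * n + ga.2)%N).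

Lemma cell_bound (al : cell) : lt (al.1 * n + al.2)%N (n * n)%N.
Proof. by case: al => -[i ?] [j ?] /=; apply/ssrnat.ltP => /=; nia. Qed.

Lemma cell_div (al : cell) : Nat.div (al.1 * n + al.2)%N n = al.1.
Proof.
case: al => -[i /= ?] [j /= /ssrnat.ltP jn].
rewrite Nat.div_add_l ?Nat.div_small ?Nat.add_0_r //; lia.
Qed.

Lemma cell_mod (al : cell) : Nat.modulo (al.1 * n + al.2)%N n = al.2.
Proof.
case: al => -[i /= ?] [j /= /ssrnat.ltP jn].
by rewrite -plusE -multE Nat.add_comm Nat.Div0.mod_add Nat.mod_small.
Qed.

Lemma cells_lim Tk T : tensor_lim (n * n) (n * n) (n * n) Tk T ->
  forall al be ga, cvgC (fun k => cells (Tk k) al be ga) (cells T al be ga).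
Proof.
move=> TT al be ga; split=> eps /TT[N HN]; exists N => k /HN
  /(_ _ _ _ (cell_bound al) (cell_bound be) (cell_bound ga)); apply: Rle_lt_trans.
  exact: (Rabs_Cmod (Csub _ _)).1.
exact: (Rabs_Cmod (Csub _ _)).2.
Qed.

Lemma cells_rank_one_sum r T : sum_of_rank_one (n * n) (n * n) (n * n) r T ->
  exists a b c : 'I_r -> cell -> R[i],
    forall al be ga, cells T al be ga = \sum_(l < r) a l al * b l be * c l ga.
Proof.
move=> [a [b [c E]]].
pose f (a : nat -> nat -> Defs.C) (l : 'I_r) (al : cell) := toC (a l (al.1 * n + al.2)%N).
exists (f a), (f b), (f c) => al be ga; rewrite /cells E; try exact: cell_bound.
by rewrite toC_sum.
Qed.

Lemma cells_red al be ga : cells (matmult_red_tensor n) al be ga = red R[i] al be ga.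
Proof.
rewrite /cells /matmult_red_tensor !cell_div !cell_mod /red.
have E (a b : nat) : Nat.eqb a b = (a == b).
  by apply/idP/eqP => /Nat.eqb_eq.
rewrite !E -subn1 minusE -!andbA; by case: [&& _, _, _ & _].
Qed.

Lemma koszul_cvg (u : nat -> cell -> cell -> cell -> R[i]) t p q :
  (forall al be ga, cvgC (fun k => u k al be ga) (t al be ga)) ->
  cvgC (fun k => koszul (u k) p q) (koszul t p q).
Proof.
move=> ut; apply: cvgC_sum => x _; do 2!(apply: cvgCM; last exact: cvgC_cst).
by apply: cvgC_sum.
Qed.

End BorderRank.

(** * The binomial estimate and the final count *)

(** Applied at k = n - 1, this is where n >= 3 enters: at k = 1 both sides equal 2. *)
Lemma central_bin_gt k : (1 < k)%N -> (k.+1 < 'C(k.*2, k))%N.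
Proof.
elim: k => // -[//|[//|k]] IH _; have {}IH := IH isT.
rewrite doubleS binS addnC binS.
have : (0 < 'C(k.+2.*2, k.+1))%N by rewrite bin_gt0; lia.
lia.
Qed.

Lemma border_rank_bound n r : (2 < n)%N ->
  border_rank_le (n * n) (n * n) (n * n) (matmult_red_tensor n) r ->
  (2 * (n * n) - n <= r)%N.
Proof.
move=> n2 [Tk [Tr Tl]]; pose N0 := 'C((n + n).-2, n.-1).
have Nle : (#|columns n| <= r * N0)%N.
  apply: (@mxrank_limit_free _ _ (fun k => flattening (cells (Tk k)) (columns n))
    (flattening (cells (matmult_red_tensor n)) (columns n))).
  - move=> i j; rewrite mxE.
    apply: (@cvgC_ext (fun k => koszul (cells (Tk k)) (enum_val i) (enum_val j))) => [k|].
      by rewrite mxE.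
    exact: koszul_cvg (cells_lim Tl).
  - rewrite (_ : flattening _ _ = flattening (red R[i] (n := n)) (columns n)).
      exact: row_free_flattening_red.
    apply/matrixP => i j; rewrite !mxE /koszul /wedge; apply: eq_bigr => x _.
    by under eq_bigr do rewrite cells_red.
  - move=> k; have [a [b [c E]]] := cells_rank_one_sum (Tr k).
    rewrite (_ : flattening _ _ = flattening
      (fun al be ga => \sum_(l < r) a l al * b l be * c l ga) (columns n)).
      by apply: rank_flattening => p; rewrite inE => /andP[/eqP].
    apply/matrixP => i j; rewrite !mxE /koszul /wedge; apply: eq_bigr => x _.
    by under eq_bigr do rewrite E.
have n0 : (0 < n)%N by lia.
have := card_columns n0.
(* Absorption and the symmetry C(2n-1, n) = C(2n-1, n-1); times n, the source dimension becomes
   (2n^2 - n) [N0]. *)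
have B1 : (n * 'C((n + n).-1, n.-1) = (n + n).-1 * N0)%N.
  have := mul_bin_diag (n + n).-1 n.-1; rewrite prednK // -/N0 => ->.
  by congr (_ * _)%N; rewrite -bin_sub; [congr 'C(_, _) |]; lia.
have N0n : (n < N0)%N.
  have := @central_bin_gt n.-1; rewrite prednK // /N0.
  by rewrite (_ : n.-1.*2 = (n + n).-2); [apply|]; lia.
(* A smaller [r] would give (2n^2 - n) [N0] <= (2n^2 - n - 1) [N0] + n, against n < [N0]. *)
move=> cc; rewrite leqNgt; apply/negP => rn.
have : (r * N0 <= (2 * (n * n) - n).-1 * N0)%N by rewrite leq_mul2r; apply/orP; right; lia.
have : (n * n * 'C((n + n).-1, n.-1) = (2 * (n * n) - n) * N0)%N.
  by rewrite -mulnA B1 mulnA; congr (_ * _)%N; nia.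
have : ((2 * (n * n) - n) * N0 = (2 * (n * n) - n).-1 * N0 + N0)%N.
  by rewrite -mulSnr prednK; lia.
lia.
Qed.

Lemma border_rank_red n r : le 3 n ->
  border_rank_le (n * n) (n * n) (n * n) (matmult_red_tensor n) r ->
  le (2 * (n * n) - n) r.
Proof. by move=> /ssrnat.leP n2 /(border_rank_bound n2) /ssrnat.leP. Qed.

End KoszulFlattening.

Theorem theorem6p1 (n : nat) (hn : (3 <= n)%nat) (r : nat) :
  border_rank_le (n * n) (n * n) (n * n) (matmult_red_tensor n) r ->
  (2 * (n * n) - n <= r)%nat.
Proof.
  exact (KoszulFlattening.border_rank_red hn).
Qed.
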